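(* Let $g$ be a $p\times p$ voting form containing candidates from a set $A$ of size $p$. Then $g$ is a DAV form (for $\alpha=\beta=1$) if and only if $g$ contains none of $m_1$, $m_2$, $m_3$ as a submatrix. Moreover, $\{m_1,m_2,m_3\}$ is a unique minimal set with this property.
   Context: A $p\times p$ voting form is a $p\times p$ matrix whose entries are candidates. Two voters have one voting card each ($\alpha=\beta=1$), so the strategies of each voter are identified with the set $A$ of candidates, $|A|=p$. A $p\times p$ voting form $g\in A^{p\times p}$ is a distributed approval voting form (DAV form) if there are bijections $\rho,\gamma:\{1,\dots,p\}\to A$ (labelings of rows and of columns) such that $g(i,j)\in\{\rho(i),\gamma(j)\}$ for all $i,j$. Define $$m_1=\begin{bmatrix} a & b \\ c & a \end{bmatrix},\qquad m_2=\begin{bmatrix} a & a \\ a & a \end{bmatrix},\qquad m_3=\begin{bmatrix} a & a & b & b \end{bmatrix},$$ where $a,b,c$ stand for arbitrary candidates with $a$ distinct from $b$ and from $c$ ($b=c$ is allowed). A matrix contains $m_i$ as a submatrix if, for some such choice of candidates, $m_i$ can be obtained, up to permuting rows and columns and up to transposition, as the matrix of entries at the intersection of some rows and some columns. Thus containing $m_3$ means that some row or some column contains two distinct candidates each at least twice. ''This property'' of a set of forbidden matrices is that a $p\times p$ voting form with candidates from a set of size $p$ is a DAV form if and only if it contains no member of the set as a submatrix. Minimality of $\{m_1,m_2,m_3\}$ means that none of the three matrices can be left out: for each $i\in\{1,2,3\}$ there exist $p$ and a $p\times p$ voting form with exactly $p$ distinct candidates which is not a DAV form and contains neither of the two matrices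 $m_j$, $j\neq i$, as a submatrix.
   Formalization: Uniqueness is stated only among sets of forbidden matrices with at most 4 entries each, comparing sets by which matrices they forbid; without a size bound it fails, e.g. {m1, m2, [a a b b; a c b d]} with a, b, c, d distinct is another minimal set with this property. *)

(* Defs.v *)
From mathcomp Require Import all_boot all_order all_algebra.

Set Implicit Arguments.
Unset Strict Implicit.
Unset Printing Implicit Defensive.

(* A p x p voting form over a candidate set A is a matrix g : 'M[A]_p; rho and
   gamma are the labelings of its rows and of its columns. *)
Definition is_DAV (p : nat) (A : finType) (g : 'M[A]_p) : Prop :=
  exists rho gamma : 'I_p -> A,
    [/\ bijective rho, bijective gamma
      & forall i j : 'I_p, g i j = rho i \/ g i j = gamma j].

(* A matrix of symbols standing for arbitrary candidates, together with the
   pairs of symbols that are required to stand for different candidates.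
   Symbols not related by [sm_distinct] may stand for the same candidate. *)
Record smatrix : Type := SMatrix {
  sm_rows : nat;
  sm_cols : nat;
  sm_symbol : 'M[nat]_(sm_rows, sm_cols);
  sm_distinct : rel nat
}.

Definition mx_of_rows (m n : nat) (s : seq (seq nat)) : 'M[nat]_(m, n) :=
  \matrix_(i < m, j < n) nth 0 (nth [::] s i) j.

(* The symbols 0, 1, 2 are a, b, c; nothing is required of b and c. *)
Definition m1 : smatrix :=
  SMatrix (mx_of_rows 2 2 [:: [:: 0; 1]; [:: 2; 0]])
          (fun x y => (x, y) \in [:: (0, 1); (0, 2)]).

Definition m2 : smatrix :=
  SMatrix (mx_of_rows 2 2 [:: [:: 0; 0]; [:: 0; 0]])
          (fun _ _ => false).

Definition m3 : smatrix :=
  SMatrix (mx_of_rows 1 4 [:: [:: 0; 0; 1; 1]])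
          (fun x y => (x, y) \in [:: (0, 1)]).

(* Only symbols that occur in the matrix are constrained. *)
Definition admissible (A : Type) (f : smatrix) (sigma : nat -> A) : Prop :=
  forall (i k : 'I_(sm_rows f)) (j l : 'I_(sm_cols f)),
    sm_distinct f (sm_symbol f i j) (sm_symbol f k l) ->
    sigma (sm_symbol f i j) <> sigma (sm_symbol f k l).

(* Injective, not necessarily increasing, selections of rows and columns
   account for submatrices up to permutations of rows and columns. *)
Definition occurs_in (A : Type) (m n : nat) (f : smatrix) (h : 'M[A]_(m, n)) :
  Prop :=
  exists (sigma : nat -> A)
         (r : 'I_(sm_rows f) -> 'I_m) (c : 'I_(sm_cols f) -> 'I_n),
    [/\ admissible f sigma, injective r, injective c
      & mxsub r c h = map_mx sigma (sm_symbol f)].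

Definition contains (A : Type) (m n : nat) (h : 'M[A]_(m, n)) (f : smatrix) :
  Prop :=
  occurs_in f h \/ occurs_in f h^T%R.

Definition characterizes_DAV (F : smatrix -> Prop) : Prop :=
  forall (p : nat) (A : finType) (g : 'M[A]_p),
    #|A| = p ->
    (is_DAV g <-> forall f : smatrix, F f -> ~ contains g f).

Definition m123 (f : smatrix) : Prop := [\/ f = m1, f = m2 | f = m3].

(* Two sets of symbolic matrices that forbid the same matrices are regarded as
   the same: a set is insensitive to permuting rows or columns, transposing and
   renaming symbols in its members, and to replacing m1 by its two cases b = c
   and b <> c. *)
Definition same_forbidden (F G : smatrix -> Prop) : Prop :=
  forall (m n : nat) (A : finType) (h : 'M[A]_(m, n)),
    (exists2 f, F f & contains h f) <-> (exists2 f, G f & contains h f).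

(* Main.v *)
Require Import Defs.
From mathcomp Require Import all_boot all_order all_algebra.
From Stdlib Require Import Classical_Prop.

(* Call a row (column) demanded by a candidate that occurs in it twice; such a
   row must be labeled by this candidate.  Absence of m1, m2, m3 says that
   demands are injective partial maps, and any bijections extending them work:
   a candidate a that occurs at a single place (i, j) is the label of some row,
   which no other candidate demands, so its entries are pairwise distinct, it
   contains a, and hence it is row i.

   For uniqueness, a matrix with at most 4 entries and without m1, m2, m3 is a
   submatrix of a DAV form, so it contains no member of a small characterizing
   set F.  Conversely each m_i (m1 split into the cases b = c and b <> c) is
   contained in a non-DAV form that contains none of the other three patterns;
   the member of F found in that form can only sit on a copy of m_i. *)

Set Implicit Arguments.
Unset Strict Implicit.
Unset Printing Implicit Defensive.

(** * Two-element index types and embeddings of matrices *)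

Lemma ord2P (P : 'I_2 -> Prop) : P ord0 -> P ord_max -> forall i, P i.
Proof.
move=> P0 P1 [[|[|//]] lti].
  by rewrite (_ : Ordinal lti = ord0) //; apply: val_inj.
by rewrite (_ : Ordinal lti = ord_max) //; apply: val_inj.
Qed.

Definition two (T : Type) (x y : T) (i : 'I_2) : T :=
  if i == ord0 then x else y.

Lemma two_inj (T : eqType) (x y : T) : x != y -> injective (two x y).
Proof.
by move=> /eqP nxy; apply: ord2P; apply: ord2P; rewrite /two //= => exy;
  case: nxy.
Qed.

Lemma contains_tr (A : Type) m n (h : 'M[A]_(m, n)) f :
  contains h^T%R f -> contains h f.
Proof. by rewrite /contains trmxK => -[]; [right|left]. Qed.

(** Candidates are renamed injectively, so that symbols required to differ still stand for different
    candidates after the renaming. *)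
Definition embeds (A B : Type) m n m' n'
    (k : 'M[A]_(m, n)) (h : 'M[B]_(m', n')) :=
  exists (iota : A -> B) (r : 'I_m -> 'I_m') (c : 'I_n -> 'I_n'),
    [/\ injective iota, injective r, injective c
      & mxsub r c h = map_mx iota k].

Lemma embeds_tr (A B : Type) m n m' n'
    (k : 'M[A]_(m, n)) (h : 'M[B]_(m', n')) :
  embeds k^T%R h -> embeds k h^T%R.
Proof.
case=> iota [r [c [ii ir ic E]]]; exists iota, c, r; split=> //.
by apply/matrixP=> i j; have /matrixP/(_ j i) := E; rewrite !mxE.
Qed.

Lemma occurs_embeds (A B : Type) m n m' n'
    (k : 'M[A]_(m, n)) (h : 'M[B]_(m', n')) f :
  embeds k h -> occurs_in f k -> occurs_in f h.
Proof.
case=> iota [r [c [ii ir ic E]]] [sigma [r' [c' [adm ir' ic' E']]]].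
exists (iota \o sigma), (r \o r'), (c \o c'); split.
- by move=> i i' j j' /adm ns /ii.
- exact: inj_comp.
- exact: inj_comp.
rewrite map_mx_comp -E'; apply/matrixP=> i j.
by have /matrixP/(_ (r' i) (c' j)) := E; rewrite !mxE.
Qed.

Lemma contains_embeds (A B : Type) m n m' n'
    (k : 'M[A]_(m, n)) (h : 'M[B]_(m', n')) f :
  embeds k h -> contains k f -> contains h f.
Proof.
move=> kh [kf|kf]; first by left; apply: occurs_embeds kf.
right; apply: occurs_embeds kf; apply: embeds_tr; by rewrite trmxK.
Qed.

Lemma mxsub_embeds (A : Type) m n m' n' (h : 'M[A]_(m, n))
    (r : 'I_m' -> 'I_m) (c : 'I_n' -> 'I_n) :
  injective r -> injective c -> embeds (mxsub r c h) h.
Proof. by move=> ir ic; exists id, r, c; split=> //; rewrite map_mx_id. Qed.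

(** * Occurrences of [m1], [m2], [m3] in terms of entries *)

Lemma occurs_m1P (A : finType) m n (h : 'M[A]_(m, n)) :
  occurs_in m1 h <->
  exists (i k : 'I_m) (j l : 'I_n),
    [/\ i != k, j != l, h i j = h k l, h i l <> h i j
      & h k j <> h i j].
Proof.
split=> [[sigma [r [c [adm ir ic /matrixP E]]]]|[i [k [j [l [ik jl E N1 N2]]]]]].
  exists (r ord0), (r ord_max), (c ord0), (c ord_max).
  have e i j := etrans (esym (mxE _ _ _ _)) (E i j).
  rewrite !inj_eq // !e !mxE /=; split=> //.
    by have := adm ord0 ord0 ord0 ord_max; rewrite !mxE /= => /(_ isT)/nesym.
  by have := adm ord0 ord_max ord0 ord0; rewrite !mxE /= => /(_ isT)/nesym.
exists (fun x => if x is 0 then h i j else if x is 1 then h i l else h k j).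
exists (two i k), (two j l); split; rewrite /=; try exact: two_inj.
  by do 4![apply: ord2P]; rewrite /= !mxE //= => _; exact: nesym.
by apply/matrixP; do 2![apply: ord2P]; rewrite !mxE.
Qed.

Lemma occurs_m2P (A : finType) m n (h : 'M[A]_(m, n)) :
  occurs_in m2 h <->
  exists (i k : 'I_m) (j l : 'I_n),
    [/\ i != k, j != l, h i l = h i j, h k j = h i j
      & h k l = h i j].
Proof.
split=> [[sigma [r [c [adm ir ic /matrixP E]]]]|[i [k [j [l [ik jl E1 E2 E3]]]]]].
  exists (r ord0), (r ord_max), (c ord0), (c ord_max).
  have e i j := etrans (esym (mxE _ _ _ _)) (E i j).
  by rewrite !inj_eq // !e !mxE.
exists (fun=> h i j), (two i k), (two j l); split=> //=; try exact: two_inj.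
by apply/matrixP; do 2![apply: ord2P]; rewrite !mxE.
Qed.

Lemma occurs_m3P (A : finType) m n (h : 'M[A]_(m, n)) :
  occurs_in m3 h <->
  exists (i : 'I_m) (j1 j2 j3 j4 : 'I_n),
    [/\ j1 != j2, j3 != j4, h i j1 = h i j2, h i j3 = h i j4
      & h i j1 <> h i j3].
Proof.
split=> [[sigma [r [c [adm ir ic /matrixP E]]]]|].
  pose o x : 'I_4 := inord x.
  exists (r ord0), (c (o 0)), (c (o 1)), (c (o 2)), (c (o 3)).
  have e i j := etrans (esym (mxE _ _ _ _)) (E i j).
  rewrite !(inj_eq ic) !e !mxE /o /= !inordK //=; split=> //.
  - by rewrite -val_eqE /= !inordK.
  - by rewrite -val_eqE /= !inordK.
  by have := adm ord0 ord0 (o 0) (o 2); rewrite !mxE /= !inordK //= => /(_ isT).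
case=> i [j1 [j2 [j3 [j4 [n12 n34 E12 E34 N]]]]].
pose c (x : 'I_4) := nth j1 [:: j1; j2; j3; j4] x.
exists (fun x => if x is 0 then h i j1 else h i j3), (fun=> i), c; split.
- move=> x y /= z t; rewrite !mxE !ord1 /= inE => /eqP[-> ->]; exact: N.
- by move=> x y; rewrite !ord1.
- move=> x y /eqP; rewrite /c nth_uniq //= => [/eqP/val_inj//|].
  (* A column of the first pair cannot equal one of the second, since the two pairs carry different
     candidates. *)
  have [n13 n14 n23 n24] : [/\ j1 != j3, j1 != j4, j2 != j3 & j2 != j4].
    by split; apply/eqP=> e; apply: N; congruence.
  by rewrite !inE !negb_or n12 n13 n14 n23 n24 n34.
apply/matrixP=> x [[|[|[|[|//]]]] lt]; rewrite !mxE !ord1 //=.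
Qed.

(** * DAV forms avoid [m1], [m2], [m3] *)

Lemma is_DAV_tr p (A : finType) (g : 'M[A]_p) : is_DAV g -> is_DAV g^T%R.
Proof.
case=> rho [gamma [br bg E]]; exists gamma, rho; split=> // i j.
by rewrite mxE; case: (E j i); [right|left].
Qed.

(** A candidate labels one row and one column only. In [m1] one a comes from its row and the other
    from its column, and where these cross the entry is forced to be a. In [m2] one row and one
    column leave a fourth a unexplained. In [m3] both candidates would have to label the row. *)
Lemma DAV_no_m123 p (A : finType) (g : 'M[A]_p) f :
  is_DAV g -> m123 f -> ~ occurs_in f g.
Proof.
case=> rho [gamma [/bij_inj ir /bij_inj ig E]].
have R (i k : 'I_p) a : i != k -> rho i = a -> rho k = a -> False.
  by move=> /eqP nik <- /ir/esym.
have C (i k : 'I_p) a : i != k -> gamma i = a -> gamma k = a -> False.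
  by move=> /eqP nik <- /ig/esym.
case=> -> => [/occurs_m1P|/occurs_m2P|/occurs_m3P].
- case=> i [k [j [l [nik njl Ea Nb Nc]]]].
  case: (E i j) => Eij; case: (E k l) => Ekl.
  + by apply: (R _ _ (g i j) nik); congruence.
  + by case: (E i l) => Eil; case: (E k j) => Ekj; congruence.
  + by case: (E i l) => Eil; case: (E k j) => Ekj; congruence.
  + by apply: (C _ _ (g i j) njl); congruence.
- case=> i [k [j [l [nik njl E1 E2 E3]]]].
  case: (E i j) (E i l) (E k j) (E k l) => e1 [] e2 [] e3 [] e4;
    by [apply: (R _ _ (g i j) nik); congruence
       |apply: (C _ _ (g i j) njl); congruence].
case=> i [j1 [j2 [j3 [j4 [n12 n34 E12 E34 N]]]]].
have e1 : g i j1 = rho i.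
  case: (E i j1) (E i j2) => // e1 [] e2; first congruence.
  by case: (C _ _ (g i j1) n12); congruence.
have e3 : g i j3 = rho i.
  case: (E i j3) (E i j4) => // e3 [] e4; first congruence.
  by case: (C _ _ (g i j3) n34); congruence.
congruence.
Qed.

(** * Labelings for forms that avoid [m1], [m2], [m3] *)

Lemma extend_bij (T A : finType) (R : T -> A -> bool) :
    #|A| = #|T| ->
    (forall x a b, R x a -> R x b -> a = b) ->
    (forall x y a, R x a -> R y a -> x = y) ->
  exists2 f : T -> A, bijective f & forall x a, R x a -> f x = a.
Proof.
move=> cardAT Rfun Rinj.
(* A candidate [a0] serves as default value below; if there is none, [T] is empty too. *)
case: (pickP (@predT A)) => [a0 _|A0]; last first.
  have T0 : #|T| = 0 by rewrite -cardAT; apply: eq_card0.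
  have vac (x : T) : False by have := fintype0 x T0.
  exists (fun x => match vac x with end) => [|x]; last by case: (vac x).
  by apply: inj_card_bij => [x|]; [case: (vac x)|rewrite cardAT].
pose D := [set x | [exists a, R x a]].
pose F x := odflt a0 [pick a | R x a].
have FP x a : R x a -> F x = a.
  rewrite /F => Rxa; case: pickP => [b /= Rxb|/(_ a)]; last by rewrite Rxa.
  exact: Rfun Rxb Rxa.
have FD x : x \in D -> R x (F x).
  by rewrite inE => /existsP[a Rxa]; rewrite (FP _ _ Rxa).
pose I := F @: D.
have Finj : {in D &, injective F}.
  by move=> x y /FD Rx /FD Ry e; apply: Rinj Rx _; rewrite e.
have cardC : #|~: I| = #|~: D|.
  by rewrite [LHS]cardsCs [RHS]cardsCs !setCK card_in_imset // cardAT.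
(* The complements of [D] and of its image [I] are matched in the order of enumeration. They have
   the same size by [cardC], so the default of [nth] is never reached there. *)
pose f x :=
  if x \in D then F x else nth a0 (enum (~: I)) (index x (enum (~: D))).
have lt x : x \notin D -> index x (enum (~: D)) < size (enum (~: I)).
  by move=> xD; rewrite -cardE cardC cardE index_mem mem_enum inE.
have fNI x : x \notin D -> f x \notin I.
  move=> xD; rewrite /f (negPf xD) -in_setC -mem_enum.
  exact/mem_nth/lt.
exists f => [|x a Rxa]; last first.
  by rewrite /f ifT ?inE; [apply: FP|apply/existsP; exists a].
apply: inj_card_bij => [x y fxy|]; last by rewrite cardAT.
case xD: (x \in D); case yD: (y \in D).
- by apply: Finj => //; move: fxy; rewrite /f xD yD.
- by have := fNI y (negbT yD); rewrite -fxy /f xD imset_f.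
- by have := fNI x (negbT xD); rewrite fxy /f yD imset_f.
move: fxy; rewrite /f xD yD => /eqP.
rewrite nth_uniq ?lt ?xD ?yD ?enum_uniq // => /eqP.
by move/index_inj; apply; rewrite // mem_enum inE ?xD ?yD.
Qed.

(* Row [i] has to be labeled [a]: a column label accounts for one of the two
   occurrences only. *)
Definition demands m n (A : finType) (g : 'M[A]_(m, n)) i a :=
  [exists j1, exists j2, [&& j1 != j2, g i j1 == a & g i j2 == a]].

Lemma demandsP m n (A : finType) (g : 'M[A]_(m, n)) i a :
  reflect (exists j1 j2 : 'I_n, [/\ j1 != j2, g i j1 = a & g i j2 = a])
          (demands g i a).
Proof.
apply: (iffP existsP) => [[j1 /existsP[j2 /and3P[n12 /eqP e1 /eqP e2]]]|].
  by exists j1, j2.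
by case=> j1 [j2 [n12 e1 e2]]; exists j1; apply/existsP; exists j2;
  rewrite n12 e1 e2 eqxx.
Qed.

Lemma demands_bij p (A : finType) (g : 'M[A]_p) :
    #|A| = p ->
    (forall f, m123 f -> ~ occurs_in f g) ->
  exists2 rho : 'I_p -> A, bijective rho
    & forall i a, demands g i a -> rho i = a.
Proof.
move=> cA no; apply: extend_bij; first by rewrite card_ord.
  move=> i a b /demandsP[j1 [j2 [n12 e1 e2]]] /demandsP[j3 [j4 [n34 e3 e4]]].
  apply: NNPP => nab; apply: (no m3); first by constructor.
  by apply/occurs_m3P; exists i, j1, j2, j3, j4; split=> //; congruence.
move=> i k a /demandsP[j1 [j2 [n12 e1 e2]]] /demandsP[l1 [l2 [n34 e3 e4]]].
apply/eqP/negPn/negP => nik.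
(* Consider the sets of columns where rows [i] and [k] carry [a]; both have at least two elements.
   Absence of [m2] ([N2]) leaves at most one common column, while absence of [m1] ([N1]) makes one
   set include the other: a contradiction. *)
have N2 j l :
    j != l -> g i j = a -> g i l = a -> g k j = a -> g k l = a -> False.
  move=> njl e5 e6 e7 e8; apply: (no m2); first by constructor.
  by apply/occurs_m2P; exists i, k, j, l; split=> //; congruence.
have N1 j l : g i j = a -> g k l = a -> g k j != a -> g i l != a -> False.
  move=> e5 e6 /eqP n7 /eqP n8; apply: (no m1); first by constructor.
  apply/occurs_m1P; exists i, k, j, l; split=> //; try congruence.
  by apply/eqP=> ejl; apply: n7; rewrite ejl.
case n1: (g k j1 == a).
  case n2: (g k j2 == a); first by apply: (N2 j1 j2) => //; apply/eqP.
  case n3: (g i l1 == a); last by apply: (N1 j2 l1); rewrite ?n2 ?n3.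
  case n4: (g i l2 == a); last by apply: (N1 j2 l2); rewrite ?n2 ?n4.
  by apply: (N2 l1 l2) => //; apply/eqP.
case n3: (g i l1 == a); last by apply: (N1 j1 l1); rewrite ?n1 ?n3.
case n4: (g i l2 == a); last by apply: (N1 j1 l2); rewrite ?n1 ?n4.
by apply: (N2 l1 l2) => //; apply/eqP.
Qed.

Lemma m123_characterizes_DAV : characterizes_DAV m123.
Proof.
move=> p A g cA; split=> [dav f mf [] of_|no].
- exact: DAV_no_m123 of_.
- by apply: DAV_no_m123 of_ => //; apply: is_DAV_tr.
have [|rho brho Erho] := @demands_bij _ _ g cA.
  by move=> f /no nf of_; apply: nf; left.
have [|gamma bgamma Egamma] := @demands_bij _ _ g^T%R cA.
  by move=> f /no nf of_; apply: nf; right.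
exists rho, gamma; split=> // i j.
have [/Erho->|/demandsP ri] := boolP (demands g i (g i j)); first by left.
have [/Egamma->|/demandsP cj] := boolP (demands g^T%R j (g i j)).
  by right.
left; set a := g i j in ri cj *.
have rowi l : g i l = a -> l = j.
  by move=> e; apply/eqP/negPn/negP => n; apply: ri; exists l, j.
have colj k : g k j = a -> k = i.
  by move=> e; apply/eqP/negPn/negP => n; apply: cj; exists k, i; rewrite !mxE.
(* A second place of [a] would lie outside row [i] and column [j], and would form [m1] together with
   (i, j). *)
have single k l : g k l = a -> k = i.
  move=> e; have [->//|/eqP nki] := eqVneq k i.
  have [el|nlj] := eqVneq l j; first by apply: colj; rewrite -el.
  case: (no m1) => //; first by constructor.
  left; apply/occurs_m1P; exists k, i, l, j; split=> //; first exact/eqP.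
    by move=> e'; apply: nki; apply: colj; rewrite e'.
  by move=> e'; case/eqP: nlj; apply: rowi; rewrite e'.
(* The row labeled [a] either is demanded by [a] or takes pairwise distinct
   values and hence meets [a]. *)
case: brho => inv rhoK invK.
suff -> : i = inv a by rewrite invK.
have [inj|] := boolP (injectiveb (g (inv a))).
  have [f _ fK] : bijective (g (inv a)).
    by apply: inj_card_bij; [apply/injectiveP|rewrite cA card_ord].
  by have /single-> := fK a.
case/injectivePn=> l1 [l2 n12 e12].
have /Erho : demands g (inv a) (g (inv a) l1) by apply/demandsP; exists l1, l2.
by rewrite invK => /esym/single.
Qed.

(** * Embedding matrices with at most four entries into DAV forms *)

(** Such a matrix contains no member of any set that characterizes DAV forms. *)
Definition DAV_embeddable (A : finType) r s (k : 'M[A]_(r, s)) : Prop :=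
  exists p (C : finType) (g : 'M[C]_p), [/\ #|C| = p, is_DAV g & embeds k g].

(* The rows and the columns of the surrounding form are indexed by the labels
   themselves, so nothing has to be extended to a bijection. *)
Lemma labeling_embeddable (A B : finType) r s (k : 'M[A]_(r, s)) (iota : A -> B)
    (rho : 'I_r -> B) (gamma : 'I_s -> B) :
    injective iota -> injective rho -> injective gamma ->
    (forall i j, iota (k i j) = rho i \/ iota (k i j) = gamma j) ->
  DAV_embeddable k.
Proof.
move=> ii ir ig E.
(* [P] marks the cells of [k] explained by their column label; [G] takes the column label there and
   the row label everywhere else. *)
pose P x y (ij : 'I_r * 'I_s) :=
  [&& rho ij.1 == x, gamma ij.2 == y & iota (k ij.1 ij.2) == y].
pose G x y := if [exists ij, P x y ij] then y else x.
pose g : 'M[B]_#|B| := (\matrix_(x, y) G (enum_val x) (enum_val y))%R.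
exists #|B|, B, g; split=> //.
  exists enum_val, enum_val; split; try exact: enum_val_bij.
  by move=> x y; rewrite mxE /G; case: ifP; [right|left].
exists iota, (enum_rank \o rho), (enum_rank \o gamma); split=> //.
- exact: inj_comp enum_rank_inj ir.
- exact: inj_comp enum_rank_inj ig.
apply/matrixP=> i j; rewrite !mxE /= !enum_rankK /G.
case: existsP => [[[i' j'] /and3P[/= /eqP/ir-> /eqP/ig-> /eqP->]] //|N].
case: (E i j) => // e; case: N; exists (i, j); by rewrite /P /= e !eqxx.
Qed.

(** Without entries any injective labelings work, and r + s fresh candidates supply them. *)
Lemma empty_embeddable (A : finType) r s (k : 'M[A]_(r, s)) : r * s = 0 ->
  DAV_embeddable k.
Proof.
move=> rs0; apply: (@labeling_embeddable _ (A + 'I_(r + s))%type _ _ k inl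
  (inr \o @lshift r s) (inr \o @rshift r s)).
- by move=> x y [].
- by move=> x y [] e; apply: val_inj.
- by move=> x y [] /addnI e; apply: val_inj.
move=> i j; have s0 : 0 < s by apply: leq_ltn_trans (ltn_ord j).
by have := leq_trans (ltn_ord i) (leq_pmulr r s0); rewrite rs0.
Qed.

(** If at most one candidate a is repeated, it labels the row; columns with another entry are
    labeled by this entry, and those with entry a get fresh labels. *)
Lemma row_dichotomy (A : finType) n (k : 'M[A]_(1, n)) :
  occurs_in m3 k \/ DAV_embeddable k.
Proof.
have dav (a : A) :
    (forall j1 j2, j1 != j2 -> k ord0 j1 = k ord0 j2 -> k ord0 j1 = a) ->
    DAV_embeddable k.
  move=> Ha; apply: (@labeling_embeddable _ (A + 'I_n)%type _ _ k inl
    (fun=> inl a) (fun j => if k ord0 j == a then inr j else inl (k ord0 j))).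
  - by move=> x y [].
  - by move=> x y _; rewrite !ord1.
  - move=> x y; case: eqP => nx; case: eqP => ny; [by case|by []|by []|].
    case=> e; apply/eqP/negPn/negP=> nxy; apply: nx; exact: Ha nxy e.
  by move=> i j; rewrite ord1; case: eqP => [->|_]; [left|right].
case: (pickP (fun a => demands k ord0 a)) => [a|none].
  case/demandsP=> j1 [j2 [n12 e1 e2]].
  case: (pickP (fun b => (b != a) && demands k ord0 b)) => [b|none].
    case/andP=> /eqP nba /demandsP[j3 [j4 [n34 e3 e4]]].
    left; apply/occurs_m3P; exists ord0, j1, j2, j3, j4.
    by split=> //; congruence.
  right; apply: (dav a) => j3 j4 n34 e; apply/eqP/negPn/negP=> na.
  have := none (k ord0 j3); rewrite na /= => /demandsP[].
  by exists j3, j4.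
(* Nothing is repeated, so any entry can play the part of a; a row of length zero offers none and is
   treated apart. *)
right; case: n k dav none => [|n] k dav none; last first.
  apply: (dav (k ord0 ord0)) => j1 j2 n12 e.
  by have /demandsP[] := none (k ord0 j1); exists j1, j2.
exact: empty_embeddable.
Qed.

(** If neither diagonal is constant, the main one labels the rows and the other one the columns. If
    one is constant a, the other two entries both differ from a ([m1]), both equal a ([m2]), or
    exactly one differs: then it labels its row, a labels the other row and one column, and one
    fresh candidate labels the last column. *)
Lemma square_dichotomy (A : finType) (k : 'M[A]_2) :
  [\/ occurs_in m1 k, occurs_in m1 k^T%R, occurs_in m2 k | DAV_embeddable k].
Proof.
set w := k ord0 ord0; set x := k ord0 ord_max.
set y := k ord_max ord0; set z := k ord_max ord_max.
have dav (r0 r1 c0 c1 : A + 'I_1) : r0 != r1 -> c0 != c1 ->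
    inl w = r0 \/ inl w = c0 -> inl x = r0 \/ inl x = c1 ->
    inl y = r1 \/ inl y = c0 -> inl z = r1 \/ inl z = c1 ->
    DAV_embeddable k.
  move=> nr nc *; apply: (@labeling_embeddable _ _ _ _ k inl
    (two r0 r1) (two c0 c1)).
  - by move=> ? ? [].
  - exact: two_inj.
  - exact: two_inj.
  by do 2![apply: ord2P].
have old (a b : A) : a <> b -> inl a != inl b :> A + 'I_1.
  by move=> nab; apply/eqP=> -[].
have [ewz|nwz] := w =P z; have [exy|nxy] := x =P y.
- have [ewx|/nesym nwx] := w =P x.
    constructor 3; apply/occurs_m2P; exists ord0, ord_max, ord0, ord_max.
    by split=> //; rewrite -/w -/x -/y -/z; congruence.
  constructor 1; apply/occurs_m1P; exists ord0, ord_max, ord0, ord_max.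
  by split=> //; rewrite -/w -/x -/y -/z; congruence.
- have [ewx|/nesym nwx] := w =P x; last have [ewy|/nesym nwy] := w =P y.
  + constructor 4; apply: (dav (inl w) (inl y) (inr ord0) (inl w)) => //;
      by [apply: old; congruence | left; congruence | right; congruence].
  + constructor 4; apply: (dav (inl x) (inl w) (inl w) (inr ord0)) => //;
      by [apply: old; congruence | left; congruence | right; congruence].
  constructor 1; apply/occurs_m1P; exists ord0, ord_max, ord0, ord_max.
  by split=> //; rewrite -/w -/x -/y -/z; congruence.
- have [ewx|nwx] := w =P x; last have [ezx|nzx] := z =P x.
  + constructor 4; apply: (dav (inl w) (inl z) (inl w) (inr ord0)) => //;
      by [apply: old; congruence | left; congruence | right; congruence].
  + constructor 4; apply: (dav (inl w) (inl z) (inr ord0) (inl z)) => //;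
      by [apply: old; congruence | left; congruence | right; congruence].
  constructor 2; apply/occurs_m1P; exists ord0, ord_max, ord_max, ord0.
  by split=> //; rewrite !mxE -/w -/x -/y -/z; congruence.
constructor 4; apply: (dav (inl w) (inl z) (inl y) (inl x));
  by [apply: old; congruence | left | right].
Qed.

Lemma small_dichotomy (A : finType) r s (k : 'M[A]_(r, s)) :
  r * s <= 4 ->
  (exists2 f, m123 f & contains k f) \/ DAV_embeddable k.
Proof.
have tr_dav : DAV_embeddable k^T%R -> DAV_embeddable k.
  case=> p [C [g [cC dg kg]]]; exists p, C, g^T%R; split=> //.
    exact: is_DAV_tr.
  exact: embeds_tr.
have [rs0|rs0 le4] := eqVneq (r * s) 0.
  by right; apply: empty_embeddable.
have [r1|r1] := eqVneq r 1; first subst r.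
  case: (row_dichotomy k) => [o|?]; [left|by right].
  by exists m3; [constructor|left].
have [s1|s1] := eqVneq s 1; first subst s.
  case: (row_dichotomy k^T%R) => [o|/tr_dav ?]; [left|by right].
  by exists m3; [constructor|right].
have [r2 s2] : r = 2 /\ s = 2.
  by move: r s r1 s1 rs0 le4 {k tr_dav} => [|[|[|r]]] [|[|[|s]]] //;
    rewrite ?muln0 // !mulnS ?mulSn !addnS.
subst r s; case: (square_dichotomy k) => [o|o|o|?]; [left..|by right].
- by exists m1; [constructor|left].
- by exists m1; [constructor|right].
by exists m2; [constructor|left].
Qed.

(** * Transposition and transfer of occurrences *)

Definition transpose (f : smatrix) : smatrix :=
  SMatrix (sm_symbol f)^T%R (sm_distinct f).

Lemma occurs_transpose (A : Type) m n (h : 'M[A]_(m, n)) f :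
  occurs_in f h -> occurs_in (transpose f) h^T%R.
Proof.
case=> sigma [r [c [adm ir ic /matrixP E]]]; exists sigma, c, r; split=> //.
  by move=> i k j l /=; rewrite !mxE; apply: adm.
by apply/matrixP=> i j; have := E j i; rewrite !mxE.
Qed.

(* When [M] tells any two different symbols apart, all its occurrences are
   isomorphic, and a submatrix which has at most the size of [M] and contains
   [M] is an occurrence of [M]. *)
Lemma occurs_transfer (M f : smatrix) (A B : finType) m n (h : 'M[B]_(m, n))
    (sigma : nat -> A) :
    (forall x y, sm_distinct M x y = (x != y)) ->
    0 < sm_rows M * sm_cols M ->
    sm_rows f * sm_cols f <= sm_rows M * sm_cols M ->
    admissible f sigma ->
    occurs_in M (map_mx sigma (sm_symbol f)) ->
    occurs_in M h -> occurs_in f h.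
Proof.
case: M f => [a b M dM] [a' b' f df] /= strict.
rewrite muln_gt0 => /andP[a0 b0] le adm.
case=> [s2 [r2 [c2 [/= adm2 ir2 ic2 /matrixP E2]]]].
case=> s3 [r3 [c3 [/= adm3 ir3 ic3 /matrixP E3]]].
(* [M] fits into a matrix with no more entries than itself, so the dimensions agree and [r2], [c2]
   are permutations. *)
have lea : a <= a' by rewrite -[a]card_ord -[a']card_ord; apply: leq_card ir2.
have leb : b <= b' by rewrite -[b]card_ord -[b']card_ord; apply: leq_card ic2.
have ea : a' <= a.
  by rewrite -(leq_pmul2r b0) (leq_trans _ le) // leq_mul2l leb orbT.
have eb : b' <= b.
  by rewrite -(leq_pmul2l a0) (leq_trans _ le) // leq_mul2r lea orbT.
have [r2' r2K r2'K] : bijective r2 by apply: inj_card_bij; rewrite ?card_ord.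
have [c2' c2K c2'K] : bijective c2 by apply: inj_card_bij; rewrite ?card_ord.
(* [iota] carries the candidates of the copy of [M] in the matrix of [f] to those of the copy in
   [h]. By [sep] the picked position has the same symbol as any other with value [x], so the choice
   does not matter. *)
pose iota x := if [pick ij : 'I_a * 'I_b | s2 (M ij.1 ij.2) == x] is Some ij
  then s3 (M ij.1 ij.2) else s3 0.
have sep (T : Type) (s : nat -> T) (adm_s : admissible (SMatrix M dM) s)
    i j k l : s (M i j) = s (M k l) -> M i j = M k l.
  move=> e; apply/eqP/negPn/negP=> nM; apply: (adm_s i k j l) => //=.
  by rewrite strict.
have iotaE i j : iota (s2 (M i j)) = s3 (M i j).
  rewrite /iota; case: pickP => [ij /eqP/(sep _ _ adm2)-> //|/(_ (i, j))].
  by rewrite /= eqxx.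
have kE i j : sigma (f i j) = s2 (M (r2' i) (c2' j)).
  by have := E2 (r2' i) (c2' j); rewrite !mxE r2'K c2'K.
exists (iota \o sigma), (r3 \o r2'), (c3 \o c2'); split.
- move=> i k j l /= dij; rewrite !kE !iotaE => /(sep _ _ adm3) e.
  by apply: (adm i k j l dij); rewrite !kE e.
- exact: inj_comp ir3 (can_inj r2'K).
- exact: inj_comp ic3 (can_inj c2'K).
apply/matrixP=> i j; rewrite !mxE /= kE iotaE.
by have := E3 (r2' i) (c2' j); rewrite !mxE.
Qed.

(** * Rigid patterns and their non-DAV witnesses *)

Definition rigid a b (t : seq (seq nat)) : smatrix :=
  SMatrix (mx_of_rows a b t) (fun x y => x != y).

(* Patterns 0 and 1 are the cases b = c and b <> c of m1. *)
Definition pattern_dims i := nth (1, 4) [:: (2, 2); (2, 2); (2, 2)] i.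
Definition pattern_rows i : seq (seq nat) :=
  nth [:: [:: 0; 0; 1; 1]]
    [:: [:: [:: 0; 1]; [:: 1; 0]]; [:: [:: 0; 1]; [:: 2; 0]];
        [:: [:: 0; 0]; [:: 0; 0]]] i.
Definition pattern i :=
  rigid (pattern_dims i).1 (pattern_dims i).2 (pattern_rows i).
(** In these tables the default of [nth] is the last case, so every index from 3 on stands for
    [m3]. *)
Definition pattern_base i : smatrix := nth m3 [:: m1; m1; m2] i.

(* The only patterns in [witness i] are occurrences of [pattern i]. *)
Definition witness_size i := (nth 3 [:: 1; 2; 2] i).+1.
Definition witness_rows i : seq (seq nat) :=
  nth [:: [:: 0; 0; 1; 1]; [:: 0; 2; 1; 3]; [:: 0; 2; 1; 3]; [:: 0; 2; 1; 3]]
    [:: [:: [:: 0; 1]; [:: 1; 0]];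
        [:: [:: 0; 1; 0]; [:: 2; 0; 0]; [:: 2; 1; 0]];
        [:: [:: 0; 0; 1]; [:: 0; 0; 1]; [:: 0; 0; 2]]] i.
Definition entry (t : seq (seq nat)) i j := nth 0 (nth [::] t i) j.
(** The candidates are the numbers below the size of the form; that size is a successor, as [inord]
    requires. *)
Definition witness i : 'M['I_(witness_size i)]_(witness_size i) :=
  (\matrix_(k, l) inord (entry (witness_rows i) k l))%R.

Lemma occurs_rename (A : Type) m n (h : 'M[A]_(m, n)) a b
    (M M' : 'M[nat]_(a, b)) (d d' : rel nat) (tau : nat -> nat) :
  M = map_mx tau M' -> (forall x y, d' x y -> d (tau x) (tau y)) ->
  occurs_in (SMatrix M d) h -> occurs_in (SMatrix M' d') h.
Proof.
move=> -> dd [sigma [r [c [adm ir ic E]]]]; exists (sigma \o tau), r, c.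
split=> //; last by rewrite E map_mx_comp.
by move=> i k j l /= /dd; have := adm i k j l; rewrite /= !mxE.
Qed.

Lemma pattern_occurs_base (A : Type) m n (h : 'M[A]_(m, n)) i :
  occurs_in (pattern i) h -> occurs_in (pattern_base i) h.
Proof.
case: i => [|[|[|i]]] /=.
(* The renaming identifies the symbols b and c of [m1]. *)
- apply: (@occurs_rename _ _ _ _ _ _ _ _ _ _
    (fun x => if x is 0 then 0 else 1)).
    by apply/matrixP; do 2![apply: ord2P]; rewrite !mxE.
  by move=> x y; rewrite !inE => /orP[] /eqP[-> ->].
- apply: (@occurs_rename _ _ _ _ _ _ _ _ _ _ id); first by rewrite map_mx_id.
  by move=> x y; rewrite !inE => /orP[] /eqP[-> ->].
- by apply: (@occurs_rename _ _ _ _ _ _ _ _ _ _ id); first by rewrite map_mx_id.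
rewrite /pattern /pattern_base /pattern_dims /pattern_rows !nth_default //=.
apply: (@occurs_rename _ _ _ _ _ _ _ _ _ _ id); first by rewrite map_mx_id.
by move=> x y; rewrite !inE => /eqP[-> ->].
Qed.

Lemma base_occurs_pattern (A : finType) m n (h : 'M[A]_(m, n)) f :
  m123 f -> occurs_in f h ->
  exists i, [/\ i < 4, pattern_base i = f & occurs_in (pattern i) h].
Proof.
case=> -> [sigma [r [c [adm ir ic E]]]].
- have n01 : sigma 1 <> sigma 0.
    by have := adm ord0 ord0 ord0 ord_max; rewrite !mxE /= => /(_ isT)/nesym.
  have n02 : sigma 2 <> sigma 0.
    by have := adm ord0 ord_max ord0 ord0; rewrite !mxE /= => /(_ isT)/nesym.
  have [e12|n12] := sigma 1 =P sigma 2.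
    exists 0; split=> //; exists sigma, r, c; split=> //.
      do 4![apply: ord2P]; rewrite /= !mxE //= => _; by [|apply/nesym].
    by rewrite E; apply/matrixP; do 2![apply: ord2P]; rewrite !mxE.
  exists 1; split=> //; exists sigma, r, c; split=> //.
  do 4![apply: ord2P]; rewrite /= !mxE //= => _; by [|apply/nesym].
- exists 2; split=> //; exists sigma, r, c; split=> //.
  by do 4![apply: ord2P]; rewrite /= !mxE.
exists 3; split=> //; exists sigma, r, c; split=> //.
have n01 : sigma 0 <> sigma 1.
  have := adm ord0 ord0 (inord 0) (inord 2); rewrite !mxE !inordK //=.
  exact.
move=> i k j l; rewrite !ord1 /= !mxE /=.
case: j l => [[|[|[|[|//]]]] lj] [[|[|[|[|//]]]] ll] //= _;
  by [|apply/nesym].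
Qed.

(** * Finite checks on the witnesses *)

Fixpoint words n k : seq (seq nat) :=
  if k is k'.+1 then [seq x :: w | x <- iota 0 n, w <- words n k']
  else [:: [::]].

Lemma mem_words n k (r : 'I_k -> 'I_n) :
  [seq val (r i) | i <- enum 'I_k] \in words n k.
Proof.
suff H (s : seq 'I_n) : map val s \in words n (size s).
  by rewrite -[X in words _ X]size_enum_ord -(size_map r) map_comp.
elim: s => [|x s IHs] //=; apply: allpairs_f => //.
by rewrite mem_iota ltn_ord.
Qed.

(** Selections of rows and columns are lists of numbers, and comparing equalities of entries with
    equalities of symbols replaces the search for [sigma]. All of it can be evaluated by
    [vm_compute]. *)
Definition occursb n (e : nat -> nat -> nat) a b (t : nat -> nat -> nat) :=
  has (fun r => uniq r && has (fun c => uniq c &&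
    all (fun i => all (fun j => all (fun k => all (fun l =>
      (e (nth 0 r i) (nth 0 c j) == e (nth 0 r k) (nth 0 c l))
      == (t i j == t k l))
    (iota 0 b)) (iota 0 a)) (iota 0 b)) (iota 0 a)) (words n b)) (words n a).

Lemma rigid_occursb (A : finType) p (h : 'M[A]_p)
    (e : nat -> nat -> nat) a b t :
  (forall i j k l : 'I_p, (h i j == h k l) = (e i j == e k l)) ->
  occurs_in (rigid a b t) h -> occursb p e a b (entry t).
Proof.
move=> he [sigma [r [c [/= adm ir ic /matrixP E]]]].
pose w m (q : 'I_m -> 'I_p) := [seq val (q i) | i <- enum 'I_m].
have uw m (q : 'I_m -> 'I_p) : injective q -> uniq (w m q).
  by move=> iq; rewrite map_inj_uniq ?enum_uniq // => x y /val_inj/iq.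
have nw m (q : 'I_m -> 'I_p) (i : 'I_m) : nth 0 (w m q) i = q i.
  by rewrite (nth_map i) ?size_enum_ord // nth_ord_enum.
apply/hasP; exists (w _ r); first exact: mem_words.
rewrite uw //=; apply/hasP; exists (w _ c); first exact: mem_words.
rewrite uw //=.
apply/allP=> i; rewrite mem_iota => /= li.
apply/allP=> j; rewrite mem_iota => /= lj.
apply/allP=> k; rewrite mem_iota => /= lk.
apply/allP=> l; rewrite mem_iota => /= ll.
rewrite (nw _ r (Ordinal li)) (nw _ r (Ordinal lk)).
rewrite (nw _ c (Ordinal lj)) (nw _ c (Ordinal ll)) -he.
have := E (Ordinal li) (Ordinal lj); have := E (Ordinal lk) (Ordinal ll).
have := adm (Ordinal li) (Ordinal lk) (Ordinal lj) (Ordinal ll).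
rewrite !mxE /= -!/(entry _ _ _) => ne -> ->; apply/eqP.
have [->|n] := eqVneq (entry t i j) (entry t k l); first by rewrite eqxx.
exact/eqP/ne.
Qed.

Lemma all_iotaP n (P : pred nat) :
  reflect (forall i, i < n -> P i) (all P (iota 0 n)).
Proof.
apply: (iffP allP) => H i; last by rewrite mem_iota => /H.
by move=> li; apply: H; rewrite mem_iota.
Qed.

Lemma witness_entry i (k l : 'I_(witness_size i)) :
  i < 4 -> val (witness i k l) = entry (witness_rows i) k l.
Proof.
move=> li; rewrite mxE /= inordK //.
have check : all (fun i => let n := witness_size i in
    all (fun k => all (fun l => entry (witness_rows i) k l < n)
      (iota 0 n)) (iota 0 n)) (iota 0 4) by vm_compute.
have /all_iotaP/(_ i li)/all_iotaP/(_ k (ltn_ord k)) := check.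
by move/all_iotaP/(_ l (ltn_ord l)).
Qed.

Lemma witness_no_other i j : i < 4 -> j < 4 -> i != j ->
  ~ contains (witness i) (pattern j).
Proof.
move=> li lj nij.
(* Exhaustive search in each witness and in its transpose. *)
have check : all (fun i => all (fun j => (i == j) ||
    ~~ (let: n := witness_size i in let: (a, b) := pattern_dims j in
        let: e := entry (witness_rows i) in
        occursb n e a b (entry (pattern_rows j))
        || occursb n (fun k l => e l k) a b (entry (pattern_rows j))))
    (iota 0 4)) (iota 0 4) by vm_compute.
have /all_iotaP/(_ i li)/all_iotaP/(_ j lj) := check.
rewrite (negPf nij) /= [pattern_dims j]surjective_pairing negb_or.
case/andP=> /negP n1 /negP n2.
case=> /rigid_occursb H; [apply: n1|apply: n2]; apply: H => x y z t.
  by rewrite -val_eqE /= !witness_entry.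
by rewrite [in LHS]mxE [X in _ == X]mxE -val_eqE /= !witness_entry.
Qed.

(** The pattern is the upper left corner of its witness. *)
Lemma witness_pattern i : i < 4 -> occurs_in (pattern i) (witness i).
Proof.
move=> li.
have check : all (fun i =>
    let: n := witness_size i in let: (a, b) := pattern_dims i in
    [&& a <= n, b <= n & all (fun k => all (fun l =>
        (entry (pattern_rows i) k l < n)
        && (entry (witness_rows i) k l == entry (pattern_rows i) k l))
      (iota 0 b)) (iota 0 a)]) (iota 0 4) by vm_compute.
have /all_iotaP/(_ i li) := check.
rewrite [pattern_dims i]surjective_pairing => /and3P[lea leb /all_iotaP eqs].
have {}eqs k l : k < (pattern_dims i).1 -> l < (pattern_dims i).2 ->
    entry (pattern_rows i) k l < (witness_size i) /\
    entry (witness_rows i) k l = entry (pattern_rows i) k l.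
  by move=> /eqs/all_iotaP H /H/andP[? /eqP].
exists inord, (widen_ord lea), (widen_ord leb); split.
- move=> x y z t /=; rewrite !mxE -!/(entry _ _ _) => /eqP ne /(congr1 val) /=.
  have [lyt _] := eqs y t (ltn_ord y) (ltn_ord t).
  by have [lxz _] := eqs x z (ltn_ord x) (ltn_ord z); rewrite !inordK.
- by move=> x y /(congr1 val) /= /val_inj.
- by move=> x y /(congr1 val) /= /val_inj.
apply/matrixP=> x y; rewrite !mxE /=.
by have [_ ->] := eqs x y (ltn_ord x) (ltn_ord y).
Qed.

Lemma witness_surj i a : i < 4 -> exists k l, witness i k l = a.
Proof.
move=> li.
have check : all (fun i => let: n := witness_size i in
    all (fun a => has (fun k => has (fun l => entry (witness_rows i) k l == a)
      (iota 0 n)) (iota 0 n)) (iota 0 n)) (iota 0 4) by vm_compute.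
have /all_iotaP/(_ i li)/all_iotaP/(_ a)/(_ (ltn_ord a)) := check.
case/hasP=> k; rewrite mem_iota => lk /hasP[l]; rewrite mem_iota => ll /eqP e.
by exists (Ordinal lk), (Ordinal ll); apply: val_inj; rewrite witness_entry.
Qed.

Lemma pattern_base_m123 i : m123 (pattern_base i).
Proof. by case: i => [|[|[|[|i]]]]; constructor. Qed.

Lemma witness_not_DAV i : i < 4 -> ~ is_DAV (witness i).
Proof.
move=> li; move/DAV_no_m123=> /(_ _ (pattern_base_m123 i)); apply.
exact/pattern_occurs_base/witness_pattern.
Qed.

(** * Uniqueness among sets of small forbidden matrices *)

Lemma contains_base_pattern (A : finType) m n (h : 'M[A]_(m, n)) f :
  m123 f -> contains h f ->
  exists i, [/\ i < 4, pattern_base i = f & contains h (pattern i)].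
Proof.
by move=> mf [] /(base_occurs_pattern mf)[i [li bi hi]]; exists i; split=> //;
  [left|right].
Qed.

Lemma occurs_self f (A : Type) (sigma : nat -> A) :
  admissible f sigma -> occurs_in f (map_mx sigma (sm_symbol f)).
Proof.
move=> adm; exists sigma, id, id; split=> //.
by apply/matrixP=> i j; rewrite [LHS]mxE.
Qed.

(** Otherwise the submatrix would lie in a DAV form, which would then contain the member [f] of
    [F]. *)
Lemma sub_contains_m123 (F : smatrix -> Prop) f (A : finType) m n
    (h : 'M[A]_(m, n)) r c :
  characterizes_DAV F -> F f -> sm_rows f * sm_cols f <= 4 ->
  @occurs_in A (sm_rows f) (sm_cols f) f (mxsub r c h) ->
  exists2 f', m123 f' & contains (mxsub r c h) f'.
Proof.
move=> charF Ff smallf fk; case: (small_dichotomy (mxsub r c h) smallf) => //.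
case=> p [C [g [cC dg kg]]].
have [/(_ dg)/(_ f Ff) nf _] := charF _ _ g cC.
by case: nf; left; apply: occurs_embeds kg fk.
Qed.

(** The copy of [f] in [w] contains some pattern, which can only be pattern [i]. As this has four
    entries, it fills the copy, and [occurs_transfer] moves [f] to [h]. Keeping [w] general covers a
    witness and its transpose. *)
Lemma contains_of_pattern (F : smatrix -> Prop) i f (A : finType) m n
    (h : 'M[A]_(m, n)) (w : 'M['I_(witness_size i)]_(witness_size i)) :
  i < 4 -> (forall j, j < 4 -> i != j -> ~ contains w (pattern j)) ->
  characterizes_DAV F -> F f -> sm_rows f * sm_cols f <= 4 ->
  occurs_in f w -> occurs_in (pattern i) h ->
  contains h f.
Proof.
move=> li other charF Ff smallf [sigma [r [c [adm ir ic E]]]] hi.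
have [|f' mf' kf'] := @sub_contains_m123 F f _ _ _ w r c charF Ff smallf.
  by rewrite E; apply: occurs_self.
have [j [lj _ kj]] := contains_base_pattern mf' kf'.
have eij : i = j.
  apply/eqP/negPn/negP=> nij; apply: (other j) => //.
  exact: contains_embeds (mxsub_embeds w ir ic) kj.
subst j; rewrite E in kj.
have dims : (pattern_dims i).1 * (pattern_dims i).2 = 4.
  by case: (i) li => [|[|[|[|]]]].
case: kj => kj.
  left; apply: (@occurs_transfer (pattern i)) kj hi => //=; rewrite dims //.
right.
(* The pattern fills the transposed copy, so the transpose of [f] is found in [h], and [f] in the
   transpose of [h]. *)
have -> : f = transpose (transpose f).
  by case: (f) => a b M d; rewrite /transpose /= trmxK.
apply: occurs_transpose.
apply: (@occurs_transfer (pattern i) _ _ _ _ _ _ sigma) => //=;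
  rewrite ?dims //.
- by rewrite mulnC.
- by move=> x y z t /=; rewrite !mxE; apply: adm.
by rewrite -map_trmx.
Qed.

Lemma small_same_forbidden (F : smatrix -> Prop) :
  characterizes_DAV F -> (forall f, F f -> sm_rows f * sm_cols f <= 4) ->
  same_forbidden F m123.
Proof.
move=> charF smallF m n A h; split.
  case=> f Ff [] [sigma [r [c [adm ir ic E]]]].
    have [|f' mf' kf'] :=
        @sub_contains_m123 F f _ _ _ h r c charF Ff (smallF f Ff).
      by rewrite E; apply: occurs_self.
    by exists f' => //; apply: contains_embeds (mxsub_embeds h ir ic) kf'.
  have [|f' mf' kf'] :=
        @sub_contains_m123 F f _ _ _ h^T%R r c charF Ff (smallF f Ff).
    by rewrite E; apply: occurs_self.
  exists f' => //; apply: contains_tr.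
  by apply: contains_embeds (mxsub_embeds _ ir ic) kf'.
case=> f0 mf0 /(contains_base_pattern mf0)[i [li _ hi]].
(* The witness is not a DAV form, so [F] has to forbid something in it. *)
have [f Ff wf] : exists2 f, F f & contains (witness i) f.
  apply: NNPP => none; apply: (witness_not_DAV li).
  by apply/charF; [rewrite card_ord|move=> f Ff wf; apply: none; exists f].
have no1 j : j < 4 -> i != j -> ~ contains (witness i) (pattern j).
  exact: witness_no_other.
have no2 j : j < 4 -> i != j -> ~ contains (witness i)^T%R (pattern j).
  by move=> lj nij /contains_tr; apply: no1.
exists f => //.
have f_occurs n' m' (h' : 'M[A]_(n', m')) :
    occurs_in (pattern i) h' -> contains h' f.
  by case: wf => wf; [apply: contains_of_pattern no1 charF Ff (smallF f Ff) wf
                     |apply: contains_of_pattern no2 charF Ff (smallF f Ff) wf].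
by case: hi => /f_occurs // /contains_tr.
Qed.

Theorem theorem16 :
  (* a form is DAV iff it contains none of m1, m2, m3 *)
  characterizes_DAV m123
  /\ (* none of m1, m2, m3 can be left out *)
  (forall f : smatrix, m123 f ->
     exists (p : nat) (A : finType) (g : 'M[A]_p),
       [/\ #|A| = p,
           (forall a : A, exists i j : 'I_p, g i j = a),
           ~ is_DAV g
         & forall f' : smatrix, m123 f' -> f' <> f -> ~ contains g f'])
  /\ (* no other set of forbidden matrices that small has the property *)
  (forall F : smatrix -> Prop,
     characterizes_DAV F ->
     (forall f : smatrix, F f -> sm_rows f * sm_cols f <= 4) ->
     same_forbidden F m123).
Proof.
split; first exact: m123_characterizes_DAV.
split; last by move=> F; apply: small_same_forbidden.
move=> f mf.
(* For [m1] the case b = c is taken; index 1 would do as well. *)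
have [i li bi] : exists2 i, i < 4 & pattern_base i = f.
  by case: mf => ->; [exists 0|exists 2|exists 3].
exists (witness_size i), 'I_(witness_size i), (witness i); split.
- exact: card_ord.
- by move=> a; apply: witness_surj.
- exact: witness_not_DAV.
move=> f' mf' nf /(contains_base_pattern mf')[j [lj bj]].
by apply: witness_no_other => //; apply/eqP=> eij; apply: nf; rewrite -bi -bj eij.
Qed.
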